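(* For all integers $m\ge1$ and $n\ge1$, with $s=m+n$, $$\binom{s}{n}=(3+2s)\sum_{i=0}^{n}(-1)^i\,\frac{\binom{2+s+n}{i}\binom{s+1}{n-i}}{(i+1)\binom{3+2s+n}{i+1}}.$$ *)

(* Defs.v *)
From HB Require Import structures.
From mathcomp Require Export all_boot all_order all_algebra.

Set Implicit Arguments.
Unset Strict Implicit.
Unset Printing Implicit Defensive.

(* Main.v *)
Require Import Defs.
From mathcomp Require Import all_boot all_order all_algebra.
From mathcomp Require Import zify ring.

Import Order.TTheory GRing.Theory Num.Theory.
Local Open Scope ring_scope.

(** Put [N = 3 + 2s + n]. The [i]-th denominator is [N 'C(N-1, i)], and
    ['C(2+s+n, i) / 'C(N-1, i) = 'C(N-1-i, s) / 'C(N-1, s)], so after the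
    substitution [j = n - i] the sum becomes, up to sign,
    [(N 'C(N-1, s))^-1 \sum_(j <= n) (-1)^j 'C(2s+2+j, s) 'C(s+1, j)].
    The latter is Gosper-summable in [n], with a hypergeometric closed form. *)

(** Both sides are the multinomial coefficient [(b + i + s)! / (b! i! s!)]. *)
Lemma bin_trinomial b i s :
  ('C(b + i, i) * 'C(b + i + s, s) = 'C(b + s, s) * 'C(b + s + i, i))%N.
Proof.
have F x y : ('C(x + y, y) * (y`! * x`!) = (x + y)`!)%N.
  by rewrite -[in RHS](bin_fact (leq_addl x y)) addnK.
have E1 := F b i; have E2 := F (b + i)%N s.
have E3 := F b s; have E4 := F (b + s)%N i.
apply/eqP; rewrite -(@eqn_pmul2r (i`! * b`! * s`!)) ?muln_gt0 ?fact_gt0 //.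
apply/eqP; transitivity ((b + i + s)`!).
  by rewrite -E2 -E1; ring.
by rewrite addnAC -E4 -E3; ring.
Qed.

(** Telescoping certificate: under alternating signs, consecutive values of the closed form differ
    by [2s + 3] times one summand. *)
Lemma alternating_bin_sum_step s n :
  ('C(s, n.+1) * (2 * s + 3 + n.+1) * 'C(2 * s + 2 + n.+1, s) +
     'C(s, n) * (2 * s + 3 + n) * 'C(2 * s + 2 + n, s) =
   (2 * s + 3) * ('C(2 * s + 2 + n.+1, s) * 'C(s + 1, n.+1)))%N.
Proof.
(* Absorption, [(2s+3+n) 'C(2s+2+n, s) = (s+3+n) 'C(2s+3+n, s)], gives all three terms the factor
   ['C(2s+3+n, s)]. *)
have := mul_bin_down (2 * s + 2 + n.+1) s.
have -> : ((2 * s + 2 + n.+1).-1 = 2 * s + 2 + n)%N by lia.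
have -> : (2 * s + 2 + n.+1 - s = s + 3 + n)%N by lia.
have -> : (2 * s + 2 + n.+1 = 2 * s + 3 + n)%N by lia.
rewrite -[('C(s, n) * _ * _)%N]mulnA => ->; rewrite addn1 binS.
(* For [n > s] both sides vanish. Otherwise, with [k = s - n], what remains after Pascal's rule is
   [(n+1) 'C(s, n+1) = k 'C(s, n)]. *)
have [le_ns | lt_sn] := leqP n s; last first.
  by rewrite (bin_small lt_sn) (bin_small (leqW lt_sn)) !mul0n !muln0.
have := mul_bin_left s n; have := subnK le_ns.
move: (s - n)%N 'C(s, n) 'C(s, n.+1) 'C(_, s) => k a b c <- E.
suff -> : (b * (2 * (k + n) + 3 + n.+1) =
           b * (2 * (k + n) + 3) + k * a)%N by ring.
by rewrite -E; ring.
Qed.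

(** Keeping [2s + 3] as a factor on the left avoids division, so the induction runs in any
    commutative ring. *)
Lemma alternating_bin_sum (R : comPzRingType) s n :
  (2 * s + 3)%:R *
    (\sum_(0 <= j < n.+1) (-1) ^+ j * ('C(2 * s + 2 + j, s) * 'C(s + 1, j))%:R)
  = (-1) ^+ n * ('C(s, n) * (2 * s + 3 + n) * 'C(2 * s + 2 + n, s))%:R :> R.
Proof.
elim: n => [|n IHn].
  by rewrite big_nat1 !expr0 !mul1r !bin0 !addn0 muln1 mul1n natrM.
rewrite big_nat_recr //= mulrDr {}IHn mulrCA -natrM -alternating_bin_sum_step.
by rewrite natrD mulrDr exprS mulN1r !mulNr addrCA subrr addr0.
Qed.

Lemma summandE (F : numFieldType) s n i : (i <= n)%N ->
  ('C(2 + s + n, i)%:R * 'C(s + 1, n - i)%:R) /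
    ((i + 1)%:R * 'C(3 + 2 * s + n, i + 1)%:R) =
  ('C(2 * s + 2 + (n - i), s) * 'C(s + 1, n - i))%:R /
    ((2 * s + 3 + n) * 'C(2 * s + 2 + n, s))%:R :> F.
Proof.
(* This choice of [b] makes [b + i + s = 2s + 2 + n], the upper index left in the denominator once
   [i + 1] is absorbed by [mul_bin_diag]. *)
move=> le_in; have := bin_trinomial (2 + s + n - i) i s.
have -> : (2 + s + n - i + i = 2 + s + n)%N by lia.
have -> : (2 + s + n + s = 2 * s + 2 + n)%N by lia.
have -> : (2 + s + n - i + s = 2 * s + 2 + (n - i))%N by lia.
have -> : (2 * s + 2 + (n - i) + i = 2 * s + 2 + n)%N by lia.
move=> E; have := mul_bin_diag (3 + 2 * s + n) i.
have -> : ((3 + 2 * s + n).-1 = 2 * s + 2 + n)%N by lia.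
rewrite -!natrM (addn1 i) => <-.
have -> : (3 + 2 * s + n = 2 * s + 3 + n)%N by lia.
apply/eqP; rewrite eqr_div; last 2 first.
- by rewrite pnatr_eq0 -lt0n muln_gt0 bin_gt0; lia.
- by rewrite pnatr_eq0 -lt0n muln_gt0 bin_gt0; lia.
rewrite -!natrM; apply/eqP; congr (_%:R).
by rewrite ![(_ * 'C(s + 1, n - i))%N]mulnC mulnACA [RHS]mulnACA E.
Qed.

Theorem theorem12 (m n s : nat) (hm : (1 <= m)%N) (hn : (1 <= n)%N)
    (hs : s = (m + n)%N) :
  'C(s, n)%:R =
    (3 + 2 * s)%:R *
    \sum_(0 <= i < n.+1)
      (-1) ^+ i *
      (('C(2 + s + n, i)%:R * 'C(s + 1, n - i)%:R) /
       ((i + 1)%:R * 'C(3 + 2 * s + n, i + 1)%:R)) :> rat.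
Proof.
set D : rat := ((2 * s + 3 + n) * 'C(2 * s + 2 + n, s))%:R.
have D_neq0 : D != 0 by rewrite pnatr_eq0 -lt0n muln_gt0 bin_gt0; lia.
(* Reversal puts [j = n - i] in the summand, while [D] is independent of [j]. *)
rewrite big_nat_rev /= add0n.
transitivity ((2 * s + 3)%:R * ((-1) ^+ n / D * \sum_(0 <= j < n.+1)
    (-1) ^+ j * ('C(2 * s + 2 + j, s) * 'C(s + 1, j))%:R)).
  (* The closed form is [(-1)^n 'C(s, n) D]: its sign squares away and [D] cancels. *)
  rewrite mulrCA alternating_bin_sum -mulnA natrM -/D mulrACA -signr_odd.
  by rewrite -expr2 sqrr_sign mul1r mulrC mulfK.
rewrite [(2 * s + 3)%N]addnC; congr (_ * _); rewrite mulr_sumr.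
apply: eq_big_nat => j /andP[_ lt_jn]; rewrite subSS.
rewrite summandE ?leq_subr // subKn // -/D.
have -> : (-1) ^+ n = (-1) ^+ (n - j) * (-1) ^+ j :> rat.
  by rewrite -exprD subnK.
have sqr_sign : (-1) ^+ j * (-1) ^+ j = 1 :> rat by rewrite -expr2 sqrr_sign.
set X := (_ * 'C(_, _))%:R; set e := (-1) ^+ j in sqr_sign *.
transitivity ((-1) ^+ (n - j) * (e * e) * (X / D)); first by ring.
by rewrite sqr_sign mulr1.
Qed.
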